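(* Let $\gamma=0$ and assume that the eigenvalues of $A$ can be anywhere in the interval $[0,\infty)$. Then the optimal relaxation parameter of the Neumann-Dirichlet algorithm ND$_2$, i.e. the minimizer $\theta^\star_{\mathrm{ND}_2}$ over $\theta\in(0,1)$ of $\sup_{d\in[0,\infty)}|r(\theta,d)|$, is $$\theta^\star_{\mathrm{ND}_2}=\frac{2}{3+\tanh\big(\sqrt{\nu^{-1}}\,\alpha\big)\tanh\big(\sqrt{\nu^{-1}}\,(T-\alpha)\big)},$$ and it satisfies $\frac12<\theta^\star_{\mathrm{ND}_2}<\frac23$.
   Context: Let $\nu>0$, $T>0$, $0<\alpha<T$, $\Omega_1=(0,\alpha)$, $\Omega_2=(\alpha,T)$. Algorithm ND$_2$ (error equations) for an eigenvalue $d\ge0$, with $\gamma=0$: given $f^0\in\mathbb{R}$, for $k=1,2,\dots$: (1) solve $\dot z_1^k+dz_1^k-\nu^{-1}\mu_1^k=0$, $\dot\mu_1^k-z_1^k-d\mu_1^k=0$ in $\Omega_1$ with $z_1^k(0)=0$, $\dot z_1^k(\alpha)=f^{k-1}$; (2) solve $\dot z_2^k+dz_2^k-\nu^{-1}\mu_2^k=0$, $\dot\mu_2^k-z_2^k-d\mu_2^k=0$ in $\Omega_2$ with $z_2^k(\alpha)=z_1^k(\alpha)$, $\mu_2^k(T)=0$; (3) set $f^k=(1-\theta)f^{k-1}+\theta\dot z_2^k(\alpha)$. Since the problem is linear, $f^k=r(\theta,d)f^{k-1}$ for a real number $r(\theta,d)$ depending only on $\theta,d,\nu,T,\alpha$;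 $|r(\theta,d)|$ is the convergence factor for the eigenvalue $d$. *)

(* Defs.v *)
From Stdlib Require Import Reals.
From Coquelicot Require Import Coquelicot.
Open Scope R_scope.

Definition is_left_derive (u : R -> R) (x l : R) : Prop :=
  filterlim (fun t => (u t - u x) / (t - x)) (at_left x) (locally l).

Definition is_right_derive (u : R -> R) (x l : R) : Prop :=
  filterlim (fun t => (u t - u x) / (t - x)) (at_right x) (locally l).

(* Continuity inside (a, b) follows from differentiability in [solves_on]. *)
Definition continuous_up_to_ends (a b : R) (u : R -> R) : Prop :=
  filterlim u (at_right a) (locally (u a)) /\
  filterlim u (at_left b) (locally (u b)).

(* Classical solutions of the forward-backward system on the open interval
   (a, b), continuous on [a, b] so that boundary values are meaningful.
   Values of z and mu outside [a, b] are irrelevant. *)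
Record solves_on (nu d a b : R) (z mu : R -> R) : Prop := {
  solves_z_ends : continuous_up_to_ends a b z;
  solves_mu_ends : continuous_up_to_ends a b mu;
  solves_z_derivable : forall t, a < t < b -> ex_derive z t;
  solves_mu_derivable : forall t, a < t < b -> ex_derive mu t;
  solves_state : forall t, a < t < b ->
    Derive z t + d * z t - / nu * mu t = 0;
  solves_adjoint : forall t, a < t < b ->
    Derive mu t - z t - d * mu t = 0
}.

(* The k-th iteration has index [S k]; entries 0 of z1, mu1, z2, mu2 are
   unused.  The derivatives of z1 and z2 at the interface alpha are one-sided,
   taken from within (0, alpha) and (alpha, T) respectively. *)
Record ND2_run (nu T alpha theta d : R)
    (f : nat -> R) (z1 mu1 z2 mu2 : nat -> R -> R) : Prop := {
  ND2_system1 : forall k, solves_on nu d 0 alpha (z1 (S k)) (mu1 (S k));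
  ND2_initial : forall k, z1 (S k) 0 = 0;
  ND2_neumann : forall k, is_left_derive (z1 (S k)) alpha (f k);
  ND2_system2 : forall k, solves_on nu d alpha T (z2 (S k)) (mu2 (S k));
  ND2_dirichlet : forall k, z2 (S k) alpha = z1 (S k) alpha;
  ND2_final : forall k, mu2 (S k) T = 0;
  ND2_update : forall k, exists g,
    is_right_derive (z2 (S k)) alpha g /\
    f (S k) = (1 - theta) * f k + theta * g
}.

Definition is_ND2_ratio (nu T alpha theta d r : R) : Prop :=
  forall f z1 mu1 z2 mu2, ND2_run nu T alpha theta d f z1 mu1 z2 mu2 ->
  forall k, f (S k) = r * f k.

(* [iota] is the description operator: the r characterized by [is_ND2_ratio].
   For d >= 0 it exists and is unique, because the two boundary value problems
   are uniquely solvable and linear, whatever f 0 is. *)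
Definition ND2_ratio (nu T alpha theta d : R) : R :=
  iota (is_ND2_ratio nu T alpha theta d).

Definition ND2_worst_factor (nu T alpha theta : R) : Rbar :=
  Lub_Rbar (fun x => exists d, 0 <= d /\ x = Rabs (ND2_ratio nu T alpha theta d)).

Definition is_minimizer_on (D : R -> Prop) (F : R -> Rbar) (x : R) : Prop :=
  D x /\ forall y, D y -> Rbar_le (F x) (F y).

(* Main.v *)
(* With s = sqrt (d^2 + 1/nu), the system gives z'' = s^2 z, so z' + s z and
   z' - s z are pure exponentials.  Transporting them from 0 to alpha and from
   alpha to T yields r(theta, d) = 1 - theta (1 + G(d)) with
     G(d) = tanh (s alpha) (s t + d) / (s + d t),   t = tanh (s (T - alpha)).
   The fraction lies in [t, 1), hence g0 <= G(d) < 1 with g0 = G(0), and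
   G(d) -> 1 as d -> oo.  So the worst factor is
   max (1 - theta (1 + g0), 2 theta - 1), a decreasing and an increasing
   function of theta, minimal exactly where the two agree. *)
Require Import Defs.
From Stdlib Require Import Reals Lra.
From Coquelicot Require Import Coquelicot.
Open Scope R_scope.

(** * Limits and one-sided derivatives at the ends of an interval *)

(** One shape serves two limits: the velocity, with [e] equal to 1, and the product with the
    integrating factor in [solves_on_transport]. *)
Lemma filterlim_Rlin_mult {F : (R -> Prop) -> Prop} {FF : Filter F}
    (p q : R) (u v e : R -> R) (x y l : R) :
  filterlim u F (locally x) -> filterlim v F (locally y) ->
  filterlim e F (locally l) ->
  filterlim (fun t => (p * u t + q * v t) * e t) F
    (locally ((p * x + q * y) * l)).
Proof.
  intros Hu Hv He.
  apply (filterlim_comp_2 (fun t => p * u t + q * v t) e Rmult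
           (G := locally (p * x + q * y)) (H := locally l)); [| exact He |].
  - apply (filterlim_comp_2 (fun t => p * u t) (fun t => q * v t) Rplus
             (G := locally (p * x)) (H := locally (q * y))).
    + exact (filterlim_comp _ _ _ u (fun z => p * z) F _ _ Hu
               (filterlim_scal_r (V := R_NormedModule) p x)).
    + exact (filterlim_comp _ _ _ v (fun z => q * z) F _ _ Hv
               (filterlim_scal_r (V := R_NormedModule) q y)).
    + exact (filterlim_plus (V := R_NormedModule) (p * x) (q * y)).
  - exact (filterlim_mult (K := R_AbsRing) (p * x + q * y) l).
Qed.

Lemma continuous_up_to_ends_continuous (a b : R) (u : R -> R) :
  continuous u a -> continuous u b -> continuous_up_to_ends a b u.
Proof.
  intros Ha Hb; split.
  - exact (filterlim_filter_le_1 _ (filter_le_within _) Ha).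
  - exact (filterlim_filter_le_1 _ (filter_le_within _) Hb).
Qed.

(** At the ends only one-sided limits are known, so the classical theorem is applied to [g],
    continuous on the whole line and equal to [u] on [a, b]. Cauchy's form is used, with the
    identity as second function. *)
Lemma MVT_up_to_ends (a b : R) (u du : R -> R) :
  a < b -> continuous_up_to_ends a b u ->
  (forall t, a < t < b -> is_derive u t (du t)) ->
  exists c, a < c < b /\ u b - u a = du c * (b - a).
Proof.
  intros Hab [Ha Hb] Hd.
  destruct (C0_extension_lt u (u a) (u b) a b Hab) as [g [Hg [Hgu [Hga Hgb]]]];
    [| exact Ha | exact Hb |].
  { intros c Hc. apply (ex_derive_continuous (V := R_NormedModule)).
    exists (du c). exact (Hd c Hc). }
  assert (Hgd : forall t, a < t < b -> derivable_pt_lim g t (du t)).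
  { intros t Ht. apply is_derive_Reals.
    apply (is_derive_ext_loc u); [| exact (Hd t Ht)].
    apply (locally_interval _ t a b); simpl; try tauto.
    intros s Hs1 Hs2. symmetry. apply Hgu. split; assumption. }
  destruct (MVT g id a b
              (fun c Hc => exist _ (du c) (Hgd c Hc))
              (fun c _ => derivable_pt_id c) Hab) as [c [Hc Heq]].
  - intros c _. apply continuity_pt_filterlim. apply Hg.
  - intros c _. apply derivable_continuous_pt, derivable_pt_id.
  - exists c. split; [exact Hc |].
    rewrite derive_pt_id in Heq. simpl in Heq. unfold id in Heq.
    rewrite Hga, Hgb in Heq. lra.
Qed.

Lemma eq_ends_of_derive_0 (a b : R) (u : R -> R) :
  a < b -> continuous_up_to_ends a b u ->
  (forall t, a < t < b -> is_derive u t 0) -> u a = u b.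
Proof.
  intros Hab Hu Hd.
  destruct (MVT_up_to_ends a b u (fun _ => 0) Hab Hu Hd) as [c [_ Hc]]. lra.
Qed.

(** The difference quotient at [t] equals [du] at some point between [t] and [b], so it inherits the
    limit of [du]. *)
Lemma left_derive_of_lim (a b : R) (u du : R -> R) :
  a < b -> continuous_up_to_ends a b u ->
  (forall t, a < t < b -> is_derive u t (du t)) ->
  filterlim du (at_left b) (locally (du b)) -> is_left_derive u b (du b).
Proof.
  intros Hab [_ Hb] Hd Hl.
  apply filterlim_locally. intros eps.
  destruct (proj1 (filterlim_locally du (du b)) Hl eps) as [del Hdel].
  assert (Hpos : 0 < Rmin del (b - a)) by (apply Rmin_pos; [apply cond_pos | lra]).
  exists (mkposreal _ Hpos). intros t Ht Htb.
  change (Rabs (t - b) < Rmin del (b - a)) in Ht.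
  pose proof (Rmin_l del (b - a)). pose proof (Rmin_r del (b - a)).
  rewrite Rabs_left in Ht by lra.
  destruct (MVT_up_to_ends t b u du Htb) as [c [Hc Heq]].
  - split; [| exact Hb].
    apply continuous_up_to_ends_continuous with (b := t);
    apply (ex_derive_continuous (V := R_NormedModule));
    exists (du t); apply Hd; lra.
  - intros s Hs. apply Hd. lra.
  - replace ((u t - u b) / (t - b)) with (du c).
    + apply Hdel; [| lra]. change (Rabs (c - b) < del).
      rewrite Rabs_left; lra.
    + replace (u t - u b) with (du c * (t - b)) by lra. field. lra.
Qed.

Lemma right_derive_of_lim (a b : R) (u du : R -> R) :
  a < b -> continuous_up_to_ends a b u ->
  (forall t, a < t < b -> is_derive u t (du t)) ->
  filterlim du (at_right a) (locally (du a)) -> is_right_derive u a (du a).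
Proof.
  intros Hab [Ha _] Hd Hl.
  apply filterlim_locally. intros eps.
  destruct (proj1 (filterlim_locally du (du a)) Hl eps) as [del Hdel].
  assert (Hpos : 0 < Rmin del (b - a)) by (apply Rmin_pos; [apply cond_pos | lra]).
  exists (mkposreal _ Hpos). intros t Ht Hta.
  change (Rabs (t - a) < Rmin del (b - a)) in Ht.
  pose proof (Rmin_l del (b - a)). pose proof (Rmin_r del (b - a)).
  rewrite Rabs_right in Ht by lra.
  destruct (MVT_up_to_ends a t u du Hta) as [c [Hc Heq]].
  - split; [exact Ha |].
    apply continuous_up_to_ends_continuous with (a := t);
    apply (ex_derive_continuous (V := R_NormedModule));
    exists (du t); apply Hd; lra.
  - intros s Hs. apply Hd. lra.
  - replace ((u t - u a) / (t - a)) with (du c).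
    + apply Hdel; [| lra]. change (Rabs (c - a) < del).
      rewrite Rabs_right; lra.
    + rewrite Heq. field. lra.
Qed.

Lemma is_left_derive_unique (u : R -> R) (x l l' : R) :
  is_left_derive u x l -> is_left_derive u x l' -> l = l'.
Proof.
  exact (filterlim_locally_unique (V := R_NormedModule) (F := at_left x) _ l l').
Qed.

Lemma is_right_derive_unique (u : R -> R) (x l l' : R) :
  is_right_derive u x l -> is_right_derive u x l' -> l = l'.
Proof.
  exact (filterlim_locally_unique (V := R_NormedModule) (F := at_right x) _ l l').
Qed.

(** * Arbitrary solutions of the system on one subdomain *)

(* The value of z' according to the state equation; unlike [Derive z] it is
   meaningful at the ends of the interval. *)
Definition velocity (nu d : R) (z mu : R -> R) (t : R) : R :=
  - d * z t + / nu * mu t.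

Section Solutions.
Variables (nu d a b : R) (z mu : R -> R).
Hypotheses (Hab : a < b) (Hsol : solves_on nu d a b z mu).

Lemma solves_on_is_derive_z t :
  a < t < b -> is_derive z t (velocity nu d z mu t).
Proof.
  intros Ht.
  replace (velocity nu d z mu t) with (Derive z t)
    by (pose proof (solves_state _ _ _ _ _ _ Hsol t Ht); unfold velocity; lra).
  apply Derive_correct. exact (solves_z_derivable _ _ _ _ _ _ Hsol t Ht).
Qed.

Lemma solves_on_is_derive_mu t : a < t < b -> is_derive mu t (z t + d * mu t).
Proof.
  intros Ht.
  replace (z t + d * mu t) with (Derive mu t)
    by (pose proof (solves_adjoint _ _ _ _ _ _ Hsol t Ht); lra).
  apply Derive_correct. exact (solves_mu_derivable _ _ _ _ _ _ Hsol t Ht).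
Qed.

Lemma velocity_ends : continuous_up_to_ends a b (velocity nu d z mu).
Proof.
  destruct (solves_z_ends _ _ _ _ _ _ Hsol) as [Hza Hzb].
  destruct (solves_mu_ends _ _ _ _ _ _ Hsol) as [Hma Hmb].
  split.
  - apply (filterlim_ext (fun t => (- d * z t + / nu * mu t) * 1)).
    { intros t. unfold velocity. ring. }
    rewrite <- (Rmult_1_r (velocity nu d z mu a)).
    apply filterlim_Rlin_mult; [assumption | assumption | apply filterlim_const].
  - apply (filterlim_ext (fun t => (- d * z t + / nu * mu t) * 1)).
    { intros t. unfold velocity. ring. }
    rewrite <- (Rmult_1_r (velocity nu d z mu b)).
    apply filterlim_Rlin_mult; [assumption | assumption | apply filterlim_const].
Qed.

(** Turns the one-sided derivative at the interface into an algebraic expression in the values of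
    [z] and [mu] there. *)
Lemma solves_on_left_derive : is_left_derive z b (velocity nu d z mu b).
Proof.
  apply (left_derive_of_lim a b z (velocity nu d z mu) Hab).
  - exact (solves_z_ends _ _ _ _ _ _ Hsol).
  - exact solves_on_is_derive_z.
  - apply velocity_ends.
Qed.

Lemma solves_on_right_derive : is_right_derive z a (velocity nu d z mu a).
Proof.
  apply (right_derive_of_lim a b z (velocity nu d z mu) Hab).
  - exact (solves_z_ends _ _ _ _ _ _ Hsol).
  - exact solves_on_is_derive_z.
  - apply velocity_ends.
Qed.

(* Since z'' = s^2 z, the combination z' + s z grows like exp (s t); [s] may
   have either sign. *)
Lemma solves_on_transport (s : R) :
  s * s = d * d + / nu ->
  velocity nu d z mu b + s * z b =
  (velocity nu d z mu a + s * z a) * exp (s * (b - a)).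
Proof.
  intros Hs.
  (* [h] is z' + s z, with z' taken from the state equation, times the integrating factor; it is
     shown to be constant. *)
  set (h := fun t => ((s - d) * z t + / nu * mu t) * exp (- s * (t - a))).
  assert (Hexp : forall t, continuous (fun t => exp (- s * (t - a))) t).
  { intros t. apply (ex_derive_continuous (V := R_NormedModule)).
    auto_derive. exact I. }
  assert (Hh : h a = h b).
  { apply eq_ends_of_derive_0; [exact Hab | |].
    - destruct (solves_z_ends _ _ _ _ _ _ Hsol) as [Hza Hzb].
      destruct (solves_mu_ends _ _ _ _ _ _ Hsol) as [Hma Hmb].
      split; apply filterlim_Rlin_mult; try assumption;
        apply (continuous_up_to_ends_continuous a b); apply Hexp.
    - intros t Ht.
      pose proof (solves_on_is_derive_z t Ht) as Hz.
      pose proof (solves_on_is_derive_mu t Ht) as Hm.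
      unfold h. auto_derive.
      + repeat split; [exists (velocity nu d z mu t) | exists (z t + d * mu t)];
          assumption.
      + assert (Dz : Derive (fun x : R => z x) t = velocity nu d z mu t)
          by exact (is_derive_unique _ _ _ Hz).
        assert (Dm : Derive (fun x : R => mu x) t = z t + d * mu t)
          by exact (is_derive_unique _ _ _ Hm).
        rewrite Dz, Dm.
        unfold velocity.
        (* The [mu] terms cancel, and the coefficient left on [z] vanishes by the choice of [s]. *)
        transitivity ((- (s * s) + d * d + / nu) * z t * exp (- s * (t + - a))).
        { ring. }
        rewrite Hs. ring. }
  unfold h in Hh. replace (- s * (a - a)) with 0 in Hh by ring.
  rewrite exp_0, Rmult_1_r in Hh.
  replace (velocity nu d z mu a + s * z a) with ((s - d) * z a + / nu * mu a)
    by (unfold velocity; ring).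
  rewrite Hh, Rmult_assoc, <- exp_plus.
  replace (- s * (b - a) + s * (b - a)) with 0 by ring.
  rewrite exp_0. unfold velocity. ring.
Qed.
End Solutions.

(** * Explicit exponential solutions *)

(** General solution of z'' = s^2 z, centred at [c] so that a homogeneous condition at [c] becomes a
    relation between [P] and [Q] free of exponentials. *)
Definition mode_z (s c P Q t : R) : R :=
  P * exp (s * (t - c)) + Q * exp (- s * (t - c)).

(** This is nu (z' + d z), the state equation solved for mu. *)
Definition mode_mu (nu d s c P Q t : R) : R :=
  nu * ((s + d) * P * exp (s * (t - c)) + (d - s) * Q * exp (- s * (t - c))).

(** The state equation holds by the choice of [mode_mu]; the adjoint one reduces to nu s^2 = nu d^2
    + 1. *)
Lemma mode_solves_on (nu d s c P Q a b : R) :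
  0 < nu -> s * s = d * d + / nu ->
  solves_on nu d a b (mode_z s c P Q) (mode_mu nu d s c P Q).
Proof.
  intros Hnu Hs.
  assert (Hz : forall t, is_derive (mode_z s c P Q) t
    (s * P * exp (s * (t - c)) - s * Q * exp (- s * (t - c)))).
  { intros t. unfold mode_z. auto_derive; [exact I | unfold Rminus; ring]. }
  assert (Hm : forall t, is_derive (mode_mu nu d s c P Q) t
    (nu * s * ((s + d) * P * exp (s * (t - c))
               - (d - s) * Q * exp (- s * (t - c))))).
  { intros t. unfold mode_mu. auto_derive; [exact I | unfold Rminus; ring]. }
  assert (Hzx : forall t, ex_derive (mode_z s c P Q) t) by (intros t; eexists; apply Hz).
  assert (Hmx : forall t, ex_derive (mode_mu nu d s c P Q) t) by (intros t; eexists; apply Hm).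
  assert (Hns : nu * (s * s) = nu * (d * d) + 1) by (rewrite Hs; field; lra).
  split.
  - apply continuous_up_to_ends_continuous;
      apply (ex_derive_continuous (V := R_NormedModule)); apply Hzx.
  - apply continuous_up_to_ends_continuous;
      apply (ex_derive_continuous (V := R_NormedModule)); apply Hmx.
  - intros t _. apply Hzx.
  - intros t _. apply Hmx.
  - intros t _. rewrite (is_derive_unique _ _ _ (Hz t)).
    unfold mode_z, mode_mu. field. lra.
  - intros t _. rewrite (is_derive_unique _ _ _ (Hm t)).
    unfold mode_z, mode_mu.
    set (e := exp _). set (e' := exp _).
    transitivity ((nu * (s * s) - (nu * (d * d) + 1)) * (P * e + Q * e')); [ring |].
    rewrite Hns. ring.
Qed.

Lemma velocity_mode (nu d s c P Q t : R) :
  0 < nu ->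
  velocity nu d (mode_z s c P Q) (mode_mu nu d s c P Q) t =
  s * (P * exp (s * (t - c)) - Q * exp (- s * (t - c))).
Proof. intros Hnu. unfold velocity, mode_z, mode_mu. field. lra. Qed.

(** * Bounds for the hyperbolic tangent *)

Lemma tanh_exp (x : R) : tanh x = (exp x - / exp x) / (exp x + / exp x).
Proof.
  unfold tanh, sinh, cosh. rewrite exp_Ropp.
  pose proof (exp_pos x). pose proof (Rinv_0_lt_compat _ H).
  field. split; nra.
Qed.

(** With a single exponential, bounds and monotonicity become immediate. *)
Lemma tanh_exp_double (x : R) : tanh x = 1 - 2 / (exp (2 * x) + 1).
Proof.
  rewrite tanh_exp. replace (2 * x) with (x + x) by ring. rewrite exp_plus.
  pose proof (exp_pos x). field. split; nra.
Qed.

Lemma tanh_lt_1 (x : R) : tanh x < 1.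
Proof.
  rewrite tanh_exp_double. pose proof (exp_pos (2 * x)).
  assert (0 < 2 / (exp (2 * x) + 1)) by (apply Rdiv_lt_0_compat; lra). lra.
Qed.

Lemma tanh_le (x y : R) : x <= y -> tanh x <= tanh y.
Proof.
  intros Hxy. rewrite !tanh_exp_double.
  pose proof (exp_pos (2 * x)).
  assert (exp (2 * x) <= exp (2 * y)).
  { destruct Hxy as [Hxy | ->]; [left; apply exp_increasing; lra | lra]. }
  assert (/ (exp (2 * y) + 1) <= / (exp (2 * x) + 1))
    by (apply Rinv_le_contravar; lra).
  unfold Rdiv. lra.
Qed.

Lemma tanh_pos (x : R) : 0 < x -> 0 < tanh x.
Proof.
  intros Hx. rewrite tanh_exp_double.
  assert (1 < exp (2 * x)) by (rewrite <- exp_0; apply exp_increasing; lra).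
  assert (/ (exp (2 * x) + 1) < / 2) by (apply Rinv_lt_contravar; lra).
  unfold Rdiv. lra.
Qed.

(** Follows from exp (2 x) > 1 + 2 x; the explicit rate supplies a concrete [d] in
    [ND2_gain_near_1]. *)
Lemma tanh_ge_1_minus_inv (x : R) : 0 < x -> 1 - / x <= tanh x.
Proof.
  intros Hx. rewrite tanh_exp_double.
  assert (1 + 2 * x < exp (2 * x)) by (apply exp_ineq1; lra).
  assert (/ (exp (2 * x) + 1) <= / (2 * x)) by (apply Rinv_le_contravar; lra).
  rewrite Rinv_mult in H0. unfold Rdiv. lra.
Qed.

(** * The gain of one iteration and the ratio r(theta, d) *)

Definition frequency (nu d : R) : R := sqrt (d * d + / nu).

(* Minus the Dirichlet-to-Neumann factor of the second subdomain times the
   Neumann-to-Dirichlet factor of the first: z_2'(alpha) = - gain * f. *)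
Definition ND2_gain (nu T alpha d : R) : R :=
  let s := frequency nu d in
  let t := tanh (s * (T - alpha)) in
  tanh (s * alpha) * ((s * t + d) / (s + d * t)).

Section Gain.
Variables (nu T alpha d : R).
Hypotheses (hnu : 0 < nu) (halpha : 0 < alpha < T) (hd : 0 <= d).

Lemma frequency_sqr : frequency nu d * frequency nu d = d * d + / nu.
Proof.
  pose proof (Rinv_0_lt_compat _ hnu). apply sqrt_sqrt. nra.
Qed.

Lemma frequency_gt : d < frequency nu d.
Proof.
  pose proof (Rinv_0_lt_compat _ hnu). pose proof frequency_sqr.
  assert (0 <= frequency nu d) by apply sqrt_pos. nra.
Qed.

Lemma frequency_ge_sqrt_inv : sqrt (/ nu) <= frequency nu d.
Proof. apply sqrt_le_1_alt. nra. Qed.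

(** Transport with both signs of [s] gives two linear relations per subdomain; eliminating the
    unknown data at 0 and at [T] leaves the map from [f] to z_2'(alpha). *)
Lemma ND2_step (z1 mu1 z2 mu2 : R -> R) (f : R) :
  solves_on nu d 0 alpha z1 mu1 -> z1 0 = 0 -> is_left_derive z1 alpha f ->
  solves_on nu d alpha T z2 mu2 -> z2 alpha = z1 alpha -> mu2 T = 0 ->
  is_right_derive z2 alpha (- (ND2_gain nu T alpha d * f)).
Proof.
  intros H1 Hz0 Hf H2 Hdir Hfin.
  pose proof (solves_on_right_derive nu d alpha T z2 mu2 (proj2 halpha) H2) as Hg.
  pose proof (solves_on_left_derive nu d 0 alpha z1 mu1 (proj1 halpha) H1) as Hl.
  pose proof (is_left_derive_unique _ _ _ _ Hf Hl) as Hfe.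
  replace (- (ND2_gain nu T alpha d * f)) with (velocity nu d z2 mu2 alpha);
    [exact Hg |].
  set (s := frequency nu d).
  assert (Hs : s * s = d * d + / nu) by apply frequency_sqr.
  assert (Hs' : - s * - s = d * d + / nu) by (rewrite <- Hs; ring).
  assert (Hsd : d < s) by apply frequency_gt.
  pose proof (solves_on_transport nu d 0 alpha z1 mu1 (proj1 halpha) H1 s Hs) as A1.
  pose proof (solves_on_transport nu d 0 alpha z1 mu1 (proj1 halpha) H1 (-s) Hs') as A2.
  pose proof (solves_on_transport nu d alpha T z2 mu2 (proj2 halpha) H2 s Hs) as B1.
  pose proof (solves_on_transport nu d alpha T z2 mu2 (proj2 halpha) H2 (-s) Hs') as B2.
  (* The condition mu_2(T) = 0 becomes the Robin condition z_2'(T) = - d z_2(T). *)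
  assert (Hw : velocity nu d z2 mu2 T = - d * z2 T)
    by (unfold velocity; rewrite Hfin; ring).
  rewrite Hw, Hdir in *. rewrite Hz0, <- Hfe, Rminus_0_r in *.
  replace (- s * alpha) with (- (s * alpha)) in A2 by ring.
  replace (- s * (T - alpha)) with (- (s * (T - alpha))) in B2 by ring.
  rewrite exp_Ropp in A2, B2.
  unfold ND2_gain. fold s. rewrite !tanh_exp.
  assert (HE : 1 < exp (s * alpha))
    by (rewrite <- exp_0; apply exp_increasing; nra).
  assert (HF : 1 < exp (s * (T - alpha)))
    by (rewrite <- exp_0; apply exp_increasing; nra).
  set (E := exp (s * alpha)) in *. set (F := exp (s * (T - alpha))) in *.
  set (w0 := velocity nu d z1 mu1 0) in *.
  set (g := velocity nu d z2 mu2 alpha) in *.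
  set (Z := z1 alpha) in *. set (Y := z2 T) in *.
  clearbody E F w0 g Z Y. clear - A1 A2 B1 B2 HE HF Hsd hd.
  rewrite Rmult_0_r, Rplus_0_r in A1, A2.
  clearbody s.
  assert (HE' : 0 < / E < 1)
    by (split; [apply Rinv_0_lt_compat | rewrite <- Rinv_1; apply Rinv_lt_contravar]; lra).
  assert (HF' : 0 < / F < 1)
    by (split; [apply Rinv_0_lt_compat | rewrite <- Rinv_1; apply Rinv_lt_contravar]; lra).
  (* Neumann-to-Dirichlet map of the first subdomain, s Z = f tanh (s alpha), by eliminating
     [w0]. *)
  assert (K1 : s * Z * (E + / E) = f * (E - / E)).
  { assert ((f + s * Z) * / E = (f - s * Z) * E); [| lra].
    rewrite A1. replace (f - s * Z) with (w0 * / E) by lra. ring. }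
  (* Dirichlet-to-Neumann map of the second subdomain, by eliminating [Y]. *)
  assert (K2 : g * ((s + d) * F + (s - d) * / F)
               = - (s * Z * ((s + d) * F - (s - d) * / F))).
  { assert ((s + d) * ((g + s * Z) * F) = - ((s - d) * ((g - s * Z) * / F)));
      [| lra].
    replace (g - s * Z) with (g + - s * Z) by ring.
    rewrite <- B1, <- B2. ring. }
  set (E' := / E) in *. set (F' := / F) in *. clearbody E' F'.
  assert (HD : 0 < (s + d) * F + (s - d) * F') by nra.
  apply (Rmult_eq_reg_r ((s + d) * F + (s - d) * F')); [| lra].
  rewrite K2.
  replace (s * Z) with (f * (E - E') / (E + E')) by (rewrite <- K1; field; lra).
  field. repeat split; nra.
Qed.

(** The fraction is at most 1 because (s - d)(1 - t) >= 0; strictness comes from tanh (s alpha) <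
    1. *)
Lemma ND2_gain_lt_1 : ND2_gain nu T alpha d < 1.
Proof.
  pose proof frequency_gt as Hs. unfold ND2_gain.
  set (s := frequency nu d) in *.
  pose proof (tanh_lt_1 (s * alpha)). pose proof (tanh_lt_1 (s * (T - alpha))).
  assert (0 < tanh (s * alpha)) by (apply tanh_pos; nra).
  assert (0 < tanh (s * (T - alpha))) by (apply tanh_pos; nra).
  set (t := tanh (s * (T - alpha))) in *. set (p := tanh (s * alpha)) in *.
  assert ((s * t + d) / (s + d * t) <= 1) by (apply Rle_div_l; nra).
  assert (0 < (s * t + d) / (s + d * t)) by (apply Rdiv_lt_0_compat; nra).
  nra.
Qed.

(** The fraction is at least t because s t + d - t (s + d t) = d (1 - t^2) >= 0. *)
Lemma ND2_gain_ge_tanh :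
  tanh (frequency nu d * alpha) * tanh (frequency nu d * (T - alpha))
  <= ND2_gain nu T alpha d.
Proof.
  pose proof frequency_gt as Hs. unfold ND2_gain.
  set (s := frequency nu d) in *.
  pose proof (tanh_lt_1 (s * (T - alpha))).
  assert (0 < tanh (s * alpha)) by (apply tanh_pos; nra).
  assert (0 < tanh (s * (T - alpha))) by (apply tanh_pos; nra).
  set (t := tanh (s * (T - alpha))) in *.
  apply Rmult_le_compat_l; [lra |].
  assert (0 <= d * t) by (apply Rmult_le_pos; lra).
  clearbody t. apply Rle_div_r; [lra |].
  assert (t * t <= 1) by nra. nra.
Qed.

Lemma ND2_gain_ge :
  tanh (sqrt (/ nu) * alpha) * tanh (sqrt (/ nu) * (T - alpha))
  <= ND2_gain nu T alpha d.
Proof.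
  eapply Rle_trans; [| exact ND2_gain_ge_tanh].
  pose proof (Rinv_0_lt_compat _ hnu) as Hi.
  pose proof (sqrt_lt_R0 _ Hi). pose proof frequency_ge_sqrt_inv.
  apply Rmult_le_compat.
  - left. apply tanh_pos. nra.
  - left. apply tanh_pos. nra.
  - apply tanh_le. nra.
  - apply tanh_le. nra.
Qed.

(** [ND2_step] shows that the value is a ratio. Its uniqueness, required by [iota], needs an actual
    run with f 0 nonzero, built here from modes. *)
Lemma ND2_ratio_gain (theta : R) :
  ND2_ratio nu T alpha theta d = 1 - theta * (1 + ND2_gain nu T alpha d).
Proof.
  set (G := ND2_gain nu T alpha d).
  assert (Hrec : is_ND2_ratio nu T alpha theta d (1 - theta * (1 + G))).
  { intros f z1 mu1 z2 mu2 Hrun k.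
    destruct (ND2_update _ _ _ _ _ _ _ _ _ _ Hrun k) as [g [Hg ->]].
    assert (Hstep := ND2_step _ _ _ _ (f k)
      (ND2_system1 _ _ _ _ _ _ _ _ _ _ Hrun k) (ND2_initial _ _ _ _ _ _ _ _ _ _ Hrun k)
      (ND2_neumann _ _ _ _ _ _ _ _ _ _ Hrun k) (ND2_system2 _ _ _ _ _ _ _ _ _ _ Hrun k)
      (ND2_dirichlet _ _ _ _ _ _ _ _ _ _ Hrun k) (ND2_final _ _ _ _ _ _ _ _ _ _ Hrun k)).
    rewrite (is_right_derive_unique _ _ _ _ Hg Hstep). fold G. ring. }
  unfold ND2_ratio. apply (iota_unique (V := R_CompleteNormedModule)); [| exact Hrec].
  intros r Hr.
  set (s := frequency nu d).
  assert (Hs : s * s = d * d + / nu) by apply frequency_sqr.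
  assert (Hsd : d < s) by apply frequency_gt.
  (* [c1] is the slope at alpha of the mode vanishing at 0; [c2] is the value at alpha of the mode
     whose mu vanishes at [T]. Dividing by them normalizes the amplitudes. *)
  set (c1 := s * (exp (s * alpha) + exp (- s * alpha))).
  set (c2 := (s - d) * exp (s * (alpha - T)) + (s + d) * exp (- s * (alpha - T))).
  assert (Hc1 : 0 < c1).
  { pose proof (exp_pos (s * alpha)). pose proof (exp_pos (- s * alpha)).
    unfold c1. apply Rmult_lt_0_compat; lra. }
  assert (Hc2 : 0 < c2).
  { pose proof (exp_pos (s * (alpha - T))). pose proof (exp_pos (- s * (alpha - T))).
    unfold c2. apply Rplus_lt_0_compat; apply Rmult_lt_0_compat; lra. }
  set (f := fun k => (1 - theta * (1 + G)) ^ k).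
  (* Iteration [S k] uses the datum [f k], hence the predecessor. *)
  set (p := fun n => f (pred n) / c1).
  set (m := fun n => mode_z s 0 (p n) (- p n) alpha / c2).
  assert (Hrun : ND2_run nu T alpha theta d f
    (fun n => mode_z s 0 (p n) (- p n)) (fun n => mode_mu nu d s 0 (p n) (- p n))
    (fun n => mode_z s T (m n * (s - d)) (m n * (s + d)))
    (fun n => mode_mu nu d s T (m n * (s - d)) (m n * (s + d)))).
  { assert (S1 : forall k, solves_on nu d 0 alpha (mode_z s 0 (p (S k)) (- p (S k)))
        (mode_mu nu d s 0 (p (S k)) (- p (S k))))
      by (intros k; apply mode_solves_on; assumption).
    assert (S2 : forall k, solves_on nu d alpha T
        (mode_z s T (m (S k) * (s - d)) (m (S k) * (s + d)))
        (mode_mu nu d s T (m (S k) * (s - d)) (m (S k) * (s + d))))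
      by (intros k; apply mode_solves_on; assumption).
    assert (I0 : forall k, mode_z s 0 (p (S k)) (- p (S k)) 0 = 0).
    { intros k. unfold mode_z. rewrite Rminus_0_r, !Rmult_0_r. ring. }
    assert (N1 : forall k,
        is_left_derive (mode_z s 0 (p (S k)) (- p (S k))) alpha (f k)).
    { intros k.
      pose proof (solves_on_left_derive _ _ _ _ _ _ (proj1 halpha) (S1 k)) as Hl.
      rewrite velocity_mode in Hl by exact hnu.
      replace (f k) with (s * (p (S k) * exp (s * (alpha - 0))
                               - - p (S k) * exp (- s * (alpha - 0)))); [exact Hl |].
      rewrite Rminus_0_r. transitivity (p (S k) * c1); [unfold c1; ring |].
      unfold p. simpl pred. field. lra. }
    assert (D2 : forall k, mode_z s T (m (S k) * (s - d)) (m (S k) * (s + d)) alpha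
        = mode_z s 0 (p (S k)) (- p (S k)) alpha).
    { intros k. transitivity (m (S k) * c2); [unfold c2, mode_z at 1; ring |].
      unfold m. field. lra. }
    assert (F2 : forall k,
        mode_mu nu d s T (m (S k) * (s - d)) (m (S k) * (s + d)) T = 0).
    { intros k. unfold mode_mu. rewrite Rminus_diag, !Rmult_0_r. ring. }
    split; try assumption.
    intros k. exists (- (G * f k)). split.
    - exact (ND2_step _ _ _ _ (f k) (S1 k) (I0 k) (N1 k) (S2 k) (D2 k) (F2 k)).
    - unfold f. simpl. ring. }
  (* Since f 0 = 1, the first update reads off [r]. *)
  pose proof (Hr _ _ _ _ _ Hrun 0%nat) as H0. unfold f in H0. simpl in H0. lra.
Qed.
End Gain.

(** * Extreme values of the gain and the worst factor *)

Lemma ND2_gain_0 (nu T alpha : R) : 0 < nu ->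
  ND2_gain nu T alpha 0 = tanh (sqrt (/ nu) * alpha) * tanh (sqrt (/ nu) * (T - alpha)).
Proof.
  intros hnu. unfold ND2_gain, frequency.
  replace (0 * 0 + / nu) with (/ nu) by ring.
  pose proof (sqrt_lt_R0 _ (Rinv_0_lt_compat _ hnu)).
  field. lra.
Qed.

Lemma ND2_gain_near_1 (nu T alpha eps : R) :
  0 < nu -> 0 < alpha < T -> 0 < eps ->
  exists d, 0 <= d /\ 1 - eps < ND2_gain nu T alpha d.
Proof.
  intros hnu halpha Heps.
  assert (Ha : 0 < / alpha) by (apply Rinv_0_lt_compat; lra).
  assert (Hb : 0 < / (T - alpha)) by (apply Rinv_0_lt_compat; lra).
  (* As p q >= p + q - 1 for p, q < 1, the gain is at least 1 - (1/alpha + 1/(T - alpha))/s; this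
     [d] and s > d make the defect less than [eps]. *)
  set (d := (/ alpha + / (T - alpha)) / eps).
  assert (hd : 0 < d) by (apply Rdiv_lt_0_compat; lra).
  exists d. split; [lra |].
  pose proof (frequency_gt nu d hnu ltac:(lra)) as Hs.
  eapply Rlt_le_trans; [| apply ND2_gain_ge_tanh; lra].
  set (s := frequency nu d) in *.
  pose proof (tanh_lt_1 (s * alpha)). pose proof (tanh_lt_1 (s * (T - alpha))).
  pose proof (tanh_ge_1_minus_inv (s * alpha) ltac:(nra)) as A.
  pose proof (tanh_ge_1_minus_inv (s * (T - alpha)) ltac:(nra)) as B.
  rewrite Rinv_mult in A, B.
  assert (Hse : / s * (/ alpha + / (T - alpha)) < eps).
  { replace (/ alpha + / (T - alpha)) with (d * eps) by (unfold d; field; lra).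
    rewrite Rmult_comm. apply Rlt_div_l; [lra |]. nra. }
  nra.
Qed.

(* The affine map G |-> 1 - theta (1 + G) is largest in modulus at an endpoint
   of the range of the gain; the endpoint G = 1 is only approached, as d -> oo. *)
Lemma ND2_worst_factor_eq (nu T alpha theta : R) :
  0 < nu -> 0 < alpha < T -> 0 < theta ->
  ND2_worst_factor nu T alpha theta =
  Rmax (1 - theta * (1 + tanh (sqrt (/ nu) * alpha) * tanh (sqrt (/ nu) * (T - alpha))))
       (2 * theta - 1).
Proof.
  intros hnu halpha Hth. apply is_lub_Rbar_unique.
  set (g0 := tanh (sqrt (/ nu) * alpha) * tanh (sqrt (/ nu) * (T - alpha))).
  split.
  - intros x [d [hd ->]]. rewrite ND2_ratio_gain by assumption. simpl.
    pose proof (ND2_gain_ge nu T alpha d hnu halpha hd) as Hlo. fold g0 in Hlo.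
    pose proof (ND2_gain_lt_1 nu T alpha d hnu halpha hd) as Hhi.
    unfold Rabs. destruct Rcase_abs.
    + eapply Rle_trans; [| apply Rmax_r]. nra.
    + eapply Rle_trans; [| apply Rmax_l]. nra.
  - intros b Hb.
    destruct b as [b | |]; [| exact I |].
    + simpl. apply Rmax_lub.
      * specialize (Hb _ (ex_intro _ 0 (conj (Rle_refl 0) eq_refl))). simpl in Hb.
        rewrite ND2_ratio_gain, ND2_gain_0 in Hb by (assumption || lra). fold g0 in Hb.
        eapply Rle_trans; [apply Rle_abs | exact Hb].
      * apply le_epsilon. intros eps Heps.
        (* The ratio has slope - theta in the gain, so tolerance [eps / theta] costs [eps]. *)
        destruct (ND2_gain_near_1 nu T alpha (eps / theta) hnu halpha) as [d [hd Hd]].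
        { apply Rdiv_lt_0_compat; lra. }
        specialize (Hb _ (ex_intro _ d (conj hd eq_refl))). simpl in Hb.
        rewrite ND2_ratio_gain in Hb by assumption.
        rewrite <- Rabs_Ropp in Hb.
        pose proof (Rle_abs (- (1 - theta * (1 + ND2_gain nu T alpha d)))).
        assert (theta * (1 - eps / theta) = theta - eps) by (field; lra).
        nra.
    (* Minus infinity bounds no nonempty set of reals. *)
    + exact (Hb _ (ex_intro _ 0 (conj (Rle_refl 0) eq_refl))).
Qed.

(** * The optimal relaxation parameter *)

Theorem theorem8 (nu T alpha : R) (hnu : 0 < nu) (hT : 0 < T)
    (halpha : 0 < alpha < T) :
  let theta_star :=
    2 / (3 + tanh (sqrt (/ nu) * alpha) * tanh (sqrt (/ nu) * (T - alpha))) in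
  (forall theta : R,
     is_minimizer_on (fun s => 0 < s < 1) (ND2_worst_factor nu T alpha) theta
     <-> theta = theta_star) /\
  1 / 2 < theta_star < 2 / 3.
Proof.
  assert (Hg : 0 < tanh (sqrt (/ nu) * alpha) * tanh (sqrt (/ nu) * (T - alpha)) < 1).
  { pose proof (sqrt_lt_R0 _ (Rinv_0_lt_compat _ hnu)).
    pose proof (tanh_pos (sqrt (/ nu) * alpha) ltac:(nra)).
    pose proof (tanh_pos (sqrt (/ nu) * (T - alpha)) ltac:(nra)).
    pose proof (tanh_lt_1 (sqrt (/ nu) * alpha)).
    pose proof (tanh_lt_1 (sqrt (/ nu) * (T - alpha))). nra. }
  pose proof (fun theta => ND2_worst_factor_eq nu T alpha theta hnu halpha) as HW.
  set (g0 := tanh (sqrt (/ nu) * alpha) * tanh (sqrt (/ nu) * (T - alpha))) in *.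
  intros theta_star.
  assert (Hbounds : 1 / 2 < theta_star < 2 / 3).
  { assert (Hinv : theta_star * (3 + g0) = 2) by (unfold theta_star; field; lra).
    clearbody theta_star. clearbody g0. split; nra. }
  assert (Heq : 1 - theta_star * (1 + g0) = 2 * theta_star - 1)
    by (unfold theta_star; field; lra).
  clearbody theta_star.
  split; [| exact Hbounds].
  assert (Hstar : ND2_worst_factor nu T alpha theta_star = 2 * theta_star - 1).
  { rewrite HW, Heq, Rmax_left by lra. reflexivity. }
  intros theta. split.
  - intros [Hth Hmin]. specialize (Hmin theta_star ltac:(lra)).
    rewrite Hstar, HW in Hmin by lra. simpl in Hmin.
    (* At a minimizer both branches are at most their common value at [theta_star]: the decreasing
       one forces theta >= theta_star, the increasing one theta <= theta_star. *)
    pose proof (Rmax_l (1 - theta * (1 + g0)) (2 * theta - 1)).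
    pose proof (Rmax_r (1 - theta * (1 + g0)) (2 * theta - 1)).
    nra.
  - intros ->. split; [lra |]. intros y Hy. rewrite Hstar, HW by lra. simpl.
    destruct (Rle_dec theta_star y) as [Hle | Hlt].
    + eapply Rle_trans; [| apply Rmax_r]. lra.
    + eapply Rle_trans; [| apply Rmax_l]. nra.
Qed.
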